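(* Let $A$ be a finite alphabet, let $P$ be a regular probability kernel on $A$, and let ${\bf X}$ be a stationary process compatible with $P$ for which the concentration of measure holds at exponential rate. Then ${\bf X}$ is the unique stationary process compatible with $P$ (i.e. every stationary process compatible with $P$ has the same law as ${\bf X}$).
   Context: A past is $\underline{x}=x_{-1}x_{-2}\ldots\in A^{-\mathbb{N}}$; for $a_{-k}^{-1}=a_{-1}\ldots a_{-k}$, $a_{-k}^{-1}\underline{x}$ is the past obtained by concatenation, whose most recent symbols are $a_{-1},\ldots,a_{-k}$. A probability kernel on $A$ is a function $P:A\times A^{-\mathbb{N}}\to[0,1]$ with $\sum_{a\in A}P(a|\underline{x})=1$ for all $\underline{x}$. It is strongly non-null if $\inf_{a,\underline{x}}P(a|\underline{x})>0$. It is continuous if $\mathrm{var}_k:=\sup_{b\in A}\sup_{a_{-k}^{-1}}\sup_{\underline{x},\underline{y}}|P(b|a_{-k}^{-1}\underline{x})-P(b|a_{-k}^{-1}\underline{y})|\to0$ as $k\to\infty$. It is regular if it is strongly non-null and continuous. A stationary process $\{X_j\}_{j\in\mathbb{Z}}$ on $A$ with law $\mu$ is compatible with $P$ if $\mu(X_0=a|X_{-\infty}^{-1}=\underline{x})=P(a|\underline{x})$ for every $a\in A$ and $\mu$-a.e. $\underline{x}$. For $f:A^n\to\mathbb{R}$ let $\delta_jf=\sup\{|f(a_1^n)-f(b_1^n)|:a_i=b_i\ \forall i\ne j\}$ and $\delta f=(\delta_1f,\ldots,\delta_nf)$, with $\|\delta f\|_{\ell_1(\mathbb{N})}=\sum_j\delta_jf$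 and $\|\delta f\|_{\ell_2(\mathbb{N})}^2=\sum_j(\delta_jf)^2$. The concentration of measure holds at exponential rate for a stationary process ${\bf X}$ if there are a constant $C$ and a strictly positive function $g$ of two variables such that for all $n>0$, $\epsilon>0$ and all (non-constant) $f:A^n\to\mathbb{R}$, $$\mathbb{P}\left(|f(X_1^n)-\mathbb{E}[f(X_1^n)]|>\epsilon\right)\le C\exp\left\{-\frac{g(\epsilon,\|\delta f\|_{\ell_1(\mathbb{N})})}{\|\delta f\|^2_{\ell_2(\mathbb{N})}}\right\}.$$ *)

(* Defs.v *)
From HB Require Import structures.
From mathcomp Require Import all_boot all_order all_algebra.
From mathcomp Require Import all_classical all_reals all_analysis.

Set Implicit Arguments.
Unset Strict Implicit.
Unset Printing Implicit Defensive.

Import Order.TTheory GRing.Theory Num.Theory.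
Import numFieldNormedType.Exports.

Local Open Scope classical_set_scope.
Local Open Scope ring_scope.

(* Measurable spaces of MathComp-Analysis are pointed, hence the distinguished
   letter; it plays no other role. *)
#[short(type="alphabetType")]
HB.structure Definition Alphabet := {A of Finite A & Pointed A}.

Definition coord_events (I : Type) (A : alphabetType) : set (set (I -> A)) :=
  [set E | exists i a, E = [set x | x i = a]].

(* A^I with the product sigma-algebra *)
Definition config (I : Type) (A : alphabetType) :=
  g_sigma_algebraType (@coord_events I A).

Lemma measurable_to_config (I : Type) (A : alphabetType) (d : measure_display)
    (T : measurableType d) (h : T -> config I A) :
  (forall i a, measurable [set t | h t i = a]) ->
  measurable_fun [set: T] h.
Proof.
move=> mh.
refine (@measurability _ _ T (config I A) setT h (@coord_events I A) erefl _).
by move=> _ [_ [i [a ->]] <-]; rewrite setTI; exact: mh.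
Qed.

Lemma measurable_coord (I : Type) (A : alphabetType) (i : I) (a : A) :
  measurable ([set x | x i = a] : set (config I A)).
Proof. by apply: sub_sigma_algebra; exists i, a. Qed.

Definition config_shift (A : alphabetType) (k : int) (x : config int A) :
  config int A := fun j => x (j + k).

(* The past x_{-1} x_{-2} ... of x is stored as k |-> x_{-(k+1)}. *)
Definition config_past (A : alphabetType) (x : config int A) : config nat A :=
  fun k => x (- (k.+1)%:Z).

Lemma measurable_shift (A : alphabetType) (k : int) :
  measurable_fun [set: config int A] (@config_shift A k).
Proof. by apply: measurable_to_config => i a; exact: measurable_coord. Qed.

Lemma measurable_past (A : alphabetType) :
  measurable_fun [set: config int A] (@config_past A).
Proof. by apply: measurable_to_config => i a; exact: measurable_coord. Qed.

HB.instance Definition _ (A : alphabetType) (k : int) :=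
  isMeasurableFun.Build _ _ _ _ (@config_shift A k) (@measurable_shift A k).
HB.instance Definition _ (A : alphabetType) :=
  isMeasurableFun.Build _ _ _ _ (@config_past A) (@measurable_past A).

Section kernels.
Variables (R : realType) (A : alphabetType).
Implicit Type P : A -> config nat A -> R.

Definition is_probability_kernel P : Prop :=
  (forall a x, 0 <= P a x <= 1) /\ (forall x, \sum_(a : A) P a x = 1).

Definition strongly_non_null P : Prop :=
  0 < inf [set r | exists a x, r = P a x].

(* w = a_{-1} ... a_{-k}, with a_{-1} at index 0 *)
Definition concat_past (k : nat) (w : k.-tuple A) (x : config nat A) :
  config nat A := fun i => nth (x (i - k)%N) w i.

Definition kernel_var P (k : nat) : R :=
  sup [set r | exists b (w : k.-tuple A) x y,
         r = `|P b (concat_past w x) - P b (concat_past w y)|].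

Definition continuous_kernel P : Prop := kernel_var P k @[k --> \oo] --> (0 : R).

Definition regular_kernel P : Prop := strongly_non_null P /\ continuous_kernel P.

End kernels.

Section processes.
Variables (R : realType) (A : alphabetType).
Variables (d : measure_display) (T : measurableType d) (Pr : probability T R).

(* g is a version of z |-> Pr (E | Z = z). *)
Definition is_cond_prob (d' : measure_display) (S : measurableType d')
    (E : set T) (Z : {RV Pr >-> S}) (g : S -> R) : Prop :=
  (distribution Pr Z).-integrable [set: S] (EFin \o g) /\
  forall B : set S, measurable B ->
    Pr (E `&` Z @^-1` B) = (\int[distribution Pr Z]_(z in B) (g z)%:E)%E.

Variable X : {RV Pr >-> config int A}.

Definition stationary : Prop :=
  forall (k : int) (B : set (config int A)), measurable B ->
    distribution Pr (@config_shift A k \o X) B = distribution Pr X B.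

(* Versions of Pr (X_0 = a | past) agree almost everywhere for the law of the
   past, so it is enough to ask that one of them equals P a. *)
Definition compatible_with (P : A -> config nat A -> R) : Prop :=
  forall a : A, exists g : config nat A -> R,
    is_cond_prob [set t | X t 0 = a] (@config_past A \o X) g /\
    {ae distribution Pr (@config_past A \o X), forall x, g x = P a x}.

(* the block (X_1, ..., X_n) *)
Definition block (n : nat) (t : T) : {ffun 'I_n -> A} :=
  [ffun i : 'I_n => X t (i.+1)%:Z].

Definition osc (n : nat) (f : {ffun 'I_n -> A} -> R) (j : 'I_n) : R :=
  sup [set r | exists a b : {ffun 'I_n -> A},
         (forall i, i != j -> a i = b i) /\ r = `|f a - f b|].

Definition osc_l1 (n : nat) (f : {ffun 'I_n -> A} -> R) : R :=
  \sum_(j < n) osc f j.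

Definition osc_l2sq (n : nat) (f : {ffun 'I_n -> A} -> R) : R :=
  \sum_(j < n) osc f j ^+ 2.

(* g is only evaluated at e > 0 and at osc_l1 f, which is positive for a
   non-constant f; hence positivity is asked on positive arguments only. *)
Definition exponential_concentration : Prop :=
  exists (C : R) (g : R -> R -> R),
    (forall e s, 0 < e -> 0 < s -> 0 < g e s) /\
    forall (n : nat) (e : R) (f : {ffun 'I_n -> A} -> R),
      (0 < n)%N -> 0 < e -> (exists a b, f a <> f b) ->
      (Pr [set t | e < `|f (block n t) -
                         fine 'E_Pr[fun s => f (block n s)]|]%R
       <= (C * expR (- (g e (osc_l1 f) / osc_l2sq f)))%:E)%E.

End processes.

Definition same_law (R : realType) (A : alphabetType)
    (d d' : measure_display) (T : measurableType d) (T' : measurableType d')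
    (Pr : probability T R) (Pr' : probability T' R)
    (X : {RV Pr >-> config int A}) (Y : {RV Pr' >-> config int A}) : Prop :=
  forall B : set (config int A), measurable B ->
    distribution Pr X B = distribution Pr' Y B.

(* Main.v *)
Require Import Defs.
From HB Require Import structures.
From mathcomp Require Import all_boot all_order all_algebra.
From mathcomp Require Import all_classical all_reals all_analysis.
From mathcomp Require Import zify ring lra.

(** Why uniqueness holds.  Let mu and nu be the laws of X and Y.  A kernel that
    is continuous and bounded below pins down conditional probabilities given a
    finite past up to a small relative error: given the n previous letters, the
    next letter has a probability in an interval of width of order [var_n],
    whatever the process, and this probability is at least
    [inf P > 0] ([cylinder_step]).  Multiplying these one-step estimates
    bounds, for every word of length n,
      nu [word] <= K_n * mu [word],    K_n = \prod_(j < n) (1 + 2 var_j / inf P)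
    ([cylinder_comparison]), hence the same bound for every event that depends
    on n consecutive letters.  As [var_j --> 0], Cesaro's theorem makes K_n grow
    more slowly than any exponential ([distortion_subexponential]).  This is a
    pointwise form of the vanishing of the relative entropy per letter.

    Now fix a word w of length k and let F be the frequency of w among m
    disjoint consecutive blocks of length k.  Under both stationary laws the mean of F is
    the probability of w ([mean_frequency]).  By the exponential concentration
    the mu-probability that F is farther than e from mu [w] is at most
    [C exp (- c m)]; by the comparison the nu-probability of the same event is
    at most [K_(m k) C exp (- c m)], which still tends to 0.  So the nu-mean
    nu [w] of F is within 2e of mu [w] ([cylinder_unique]), and the two laws
    agree on cylinders, therefore everywhere.

    Disjoint blocks, rather than all positions, are what makes the concentration
    hypothesis usable: the rate function g is arbitrary in its second argument,
    so the l1-norm of the oscillations of F must not vary with m.  With disjoint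
    blocks every coordinate has oscillation exactly 1/m; the l1-norm is k for
    every m and the squared l2-norm is k/m ([osc_l1_frequency],
    [osc_l2sq_frequency]).  This needs two letters; over a one-letter alphabet
    all cylinders have probability 1. *)

Set Implicit Arguments.
Unset Strict Implicit.
Unset Printing Implicit Defensive.

Import Order.TTheory GRing.Theory Num.Theory.
Import numFieldNormedType.Exports.

Local Open Scope classical_set_scope.
Local Open Scope ring_scope.

(** * Cylinders and shift-invariant laws *)

Section cylinders.
Variables (A : alphabetType).
Implicit Types (w : nat -> A) (x : config int A).

(** Words are infinite sequences of which only the first n letters count, so
    that lengthening a word by one letter needs no change of type. *)
Definition cylinder (k : int) (n : nat) w : set (config int A) :=
  [set x | forall i, (i < n)%N -> x (k + i%:Z) = w i].

Definition word (k : int) (n : nat) x : {ffun 'I_n -> A} :=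
  [ffun i : 'I_n => x (k + i%:Z)].

(** Padding with [point] lies outside the range that [cylinder] inspects. *)
Definition letters (n : nat) (a : {ffun 'I_n -> A}) (i : nat) : A :=
  if insub i is Some j then a j else point.

Lemma lettersE n (a : {ffun 'I_n -> A}) (i : 'I_n) : letters a i = a i.
Proof. by rewrite /letters valK. Qed.

Lemma word_letters k n x (a : {ffun 'I_n -> A}) :
  (word k n x = a) <-> cylinder k n (letters a) x.
Proof.
split=> [<- i ltin|xa].
  by rewrite -[i]/(val (Ordinal ltin)) lettersE ffunE.
by apply/ffunP => i; rewrite ffunE xa// lettersE.
Qed.

Lemma measurable_cylinder k n w : measurable (cylinder k n w).
Proof.
have -> : cylinder k n w =
    \bigcap_(i in `I_n) [set x : config int A | x (k + i%:Z) = w i] by [].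
by apply: bigcap_measurableType => i _; exact: measurable_coord.
Qed.

Lemma measurable_word k n (Q : {pred {ffun 'I_n -> A}}) :
  measurable [set x : config int A | Q (word k n x)].
Proof.
have -> : [set x : config int A | Q (word k n x)] =
    \bigcup_(a in [set a | Q a]) cylinder k n (letters a).
  apply/seteqP; split=> x /= => [Qx|[a Qa /word_letters ->]//].
  by exists (word k n x) => //; exact/word_letters.
by apply: fin_bigcup_measurable => // a _; exact: measurable_cylinder.
Qed.

End cylinders.

Section laws.
Variables (R : realType) (A : alphabetType).
Implicit Types (w : nat -> A) (mu : probability (config int A) R).

Definition shift_invariant mu : Prop :=
  forall (k : int) B, measurable B -> mu (@config_shift A k @^-1` B) = mu B.

(** The real value of a probability: the estimates below subtract and divide. *)
Definition pr mu (B : set (config int A)) : R := fine (mu B).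

Lemma prE mu B : measurable B -> (pr mu B)%:E = mu B.
Proof. by move=> mB; rewrite fineK// fin_num_measure. Qed.

Lemma pr_cylinder_shift mu k l n w : shift_invariant mu ->
  pr mu (cylinder k n w) = pr mu (cylinder l n w).
Proof.
move=> inv; rewrite /pr -(inv (k - l) (cylinder l n w))//; last first.
  exact: measurable_cylinder.
congr (fine (mu _)); apply/seteqP; split=> x xw i ltin;
  by have := xw i ltin;
     rewrite /config_shift (_ : l + i%:Z + (k - l) = k + i%:Z)//; ring.
Qed.

Lemma pr_word mu k n (Q : {pred {ffun 'I_n -> A}}) :
  pr mu [set x | Q (word k n x)] =
  \sum_(a | Q a) pr mu (cylinder k n (letters a)).
Proof.
rewrite /pr sum_fine; last first.
  by move=> a _; rewrite fin_num_measure//; exact: measurable_cylinder.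
have -> : [set x : config int A | Q (word k n x)] =
    \bigcup_(a in [set a | Q a]) cylinder k n (letters a).
  apply/seteqP; split=> x /= => [Qx|[a Qa /word_letters ->]//].
  by exists (word k n x) => //; exact/word_letters.
congr fine; rewrite measure_fin_bigcup//=.
- rewrite (@fsbigE _ _ _ _ _ (enum Q)) ?enum_uniq//=.
  + rewrite big_enum_cond/=; apply: eq_bigl => a; rewrite -[a \in Q]/(Q a).
    by case: (boolP (Q a)) => // Qa; exact/mem_set.
  + by move=> a /=; rewrite mem_enum.
  + by move=> a Qa; rewrite mem_enum -[a \in Q]/(Q a) Qa.
- move=> a b _ _ [x [/word_letters <- /word_letters <-]]//.
- by move=> a _; exact: measurable_cylinder.
Qed.
End laws.

(** * Regular kernels *)

Section kernels.
Variables (R : realType) (A : alphabetType) (P : A -> config nat A -> R).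
Hypotheses (kernelP : is_probability_kernel P).

Definition kernel_floor : R := inf [set r | exists a x, r = P a x].

Lemma kernel_floor_le a x : kernel_floor <= P a x.
Proof.
apply: ge_inf; last by exists a, x.
by exists 0 => _ [b [y ->]]; have /andP[] := kernelP.1 b y.
Qed.

Lemma kernel_var_has_ubound k : has_ubound
  [set r | exists b (w : k.-tuple A) x y,
     r = `|P b (concat_past w x) - P b (concat_past w y)|].
Proof.
exists 1 => _ [b [w [x [y ->]]]].
have /andP[x0 x1] := kernelP.1 b (concat_past w x).
have /andP[y0 y1] := kernelP.1 b (concat_past w y).
by rewrite ler_norml; apply/andP; split; lra.
Qed.

Lemma kernel_var_ge0 k : 0 <= kernel_var P k.
Proof.
apply: le_trans (ub_le_sup (kernel_var_has_ubound k) _); last first.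
  by exists point, [tuple of nseq k point], (fun=> point), (fun=> point).
exact: normr_ge0.
Qed.

Lemma concat_past_split k (x : config nat A) :
  concat_past [tuple x i | i < k] (fun i => x (i + k)%N) = x.
Proof.
apply/funext => i; rewrite /concat_past.
have [ltik|leki] := ltnP i k.
  by rewrite -[i]/(val (Ordinal ltik)) -tnth_nth tnth_mktuple.
by rewrite nth_default ?size_tuple// subnK.
Qed.

Lemma kernel_varP k b (x y : config nat A) :
  (forall i, (i < k)%N -> x i = y i) -> `|P b x - P b y| <= kernel_var P k.
Proof.
move=> xy; apply: ub_le_sup (kernel_var_has_ubound k) _ _.
exists b, [tuple x i | i < k], (fun i => x (i + k)%N), (fun i => y (i + k)%N).
rewrite concat_past_split.
suff -> : [tuple x i | i < k] = [tuple y i | i < k].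
  by rewrite concat_past_split.
by apply: eq_from_tnth => i; rewrite !tnth_mktuple xy.
Qed.

End kernels.

(** * Extending a word by one letter *)

Section one_step.
Variables (R : realType) (A : alphabetType) (P : A -> config nat A -> R).
Hypotheses (kernelP : is_probability_kernel P).
Variables (d : measure_display) (T : measurableType d) (Pr : probability T R).
Variable X : {RV Pr >-> config int A}.
Hypotheses (statX : stationary X) (compX : compatible_with X P).

Definition law : probability (config int A) R := distribution Pr X.

Lemma law_shift_invariant : shift_invariant law.
Proof. by move=> k B mB; exact: statX. Qed.

(** The version g of the conditional probability is only almost everywhere equal
    to [P a]; integrating over B minus the exceptional null set N turns the
    pointwise bounds on [P a] into bounds on the integral of g. *)
Lemma compatible_bounds a (B : set (config nat A)) l u :
  measurable B -> (forall x, B x -> l <= P a x <= u) ->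
  l * pr law (@config_past A @^-1` B)
    <= pr law ([set x | x 0 = a] `&` @config_past A @^-1` B)
    <= u * pr law (@config_past A @^-1` B).
Proof.
move=> mB Plu; have [g [[intg condg] [N [mN N0 gN]]]] := compX a.
set D := distribution Pr (@config_past A \o X).
have mpB : measurable (@config_past A @^-1` B).
  by rewrite -[_ @^-1` _]setTI; exact: measurable_past.
have intB (h : config nat A -> \bar R) :
    D.-integrable setT h -> D.-integrable (B `\` N) h.
  by apply: integrableS => //; exact: measurableD.
have intc (c : R) : D.-integrable setT (EFin \o cst c).
  exact: finite_measure_integrable_cst.
have constB (c : R) : (\int[D]_(x in B `\` N) (cst c%:E) x)%E =
    (c * pr law (@config_past A @^-1` B))%:E.
  rewrite -negligible_integral//; last first.
    by apply: integrableS (intc c) => //.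
  by rewrite integral_cst// EFinM prE.
have condB : (pr law ([set x | x 0 = a] `&` @config_past A @^-1` B))%:E =
    (\int[D]_(x in B `\` N) (g x)%:E)%E.
  rewrite -negligible_integral//; last exact: integrableS intg.
  rewrite -condg// prE//; apply: measurableI => //; exact: measurable_coord.
have gP x : (B `\` N) x -> l <= g x <= u.
  move=> [Bx Nx]; suff -> : g x = P a x by exact: Plu.
  by apply: contrapT => ne; apply: Nx; exact: gN.
rewrite -!lee_fin condB -!constB; apply/andP; split; apply: le_integral => //;
  rewrite ?inE; try exact: measurableD; try exact: (intB _ (intc _));
  try exact: intB.
- by move=> x; rewrite inE => /gP/andP[lg _]; rewrite lee_fin.
- by move=> x; rewrite inE => /gP/andP[_ gu]; rewrite lee_fin.
Qed.

(** A past that ends with the first n letters of w.  The predecessor and the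
    truncated subtraction repeat the letter [w 0] further back: any remote
    past serves as the reference point of [cylinder_step]. *)
Definition reversed_word (w : nat -> A) (n : nat) : config nat A :=
  fun i => w (n.-1 - i)%N.

(** By stationarity the word may be placed so that its last letter sits at time
    0.  Its other letters are then the n most recent symbols of the past, and on
    pasts sharing them [P (w n)] varies by at most [kernel_var P n].  The
    maximum with the floor keeps the lower factor positive when the variation
    is not yet small. *)
Lemma cylinder_step (w : nat -> A) (n : nat) :
  Num.max (P (w n) (reversed_word w n) - kernel_var P n) (kernel_floor P)
      * pr law (cylinder 0 n w)
    <= pr law (cylinder 0 n.+1 w)
    <= (P (w n) (reversed_word w n) + kernel_var P n)
         * pr law (cylinder 0 n w).
Proof.
set L := P _ _; set v := kernel_var P n.
pose B : set (config nat A) :=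
  [set x | forall i, (i < n)%N -> x i = reversed_word w n i].
have mB : measurable B.
  have -> : B = \bigcap_(i in `I_n)
      [set x : config nat A | x i = reversed_word w n i] by [].
  by apply: bigcap_measurableType => i _; exact: measurable_coord.
rewrite (pr_cylinder_shift 0 (- n%:Z) n w law_shift_invariant).
rewrite (pr_cylinder_shift 0 (- n%:Z) n.+1 w law_shift_invariant).
have cylB : cylinder (- n%:Z) n w = @config_past A @^-1` B.
  apply/seteqP; split=> x xw i ltin; rewrite /config_past /reversed_word.
    by rewrite -xw; [congr x|]; lia.
  have := xw (n.-1 - i)%N; rewrite /config_past /reversed_word.
  rewrite (_ : n.-1 - (n.-1 - i) = i)%N; last lia.
  by move=> <-; [congr x|]; lia.
have cylS : cylinder (- n%:Z) n.+1 w =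
    [set x | x 0 = w n] `&` @config_past A @^-1` B.
  rewrite -cylB; apply/seteqP; split=> x => [xw|[/= x0 xw]].
    split=> [/=|i ltin]; last by rewrite xw// ltnW.
    by rewrite -xw//; congr x; lia.
  move=> i; rewrite ltnS leq_eqVlt => /orP[/eqP ->|/xw//].
  by rewrite addrC subrr.
rewrite cylS cylB; set c := pr law (_ @^-1` _); set c' := pr law (_ `&` _).
have c0 : 0 <= c by rewrite /c /pr fine_ge0.
have PLv x : B x -> L - v <= P (w n) x <= L + v.
  by move=> Bx; rewrite -ler_distlC distrC; exact: kernel_varP.
have Pfl x : B x -> kernel_floor P <= P (w n) x <= L + v.
  by move=> /PLv/andP[_ ->]; rewrite kernel_floor_le.
have /andP[lo hi] := compatible_bounds mB PLv.
have /andP[fl _] := compatible_bounds mB Pfl.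
rewrite hi andbT maxEle; by case: ifP => _.
Qed.

End one_step.
Arguments law {R A d T Pr} X.

(** * Comparison of two compatible laws *)

Section comparison.
Variables (R : realType) (A : alphabetType) (P : A -> config nat A -> R).
Hypotheses (kernelP : is_probability_kernel P) (regularP : regular_kernel P).
Variables (d : measure_display) (T : measurableType d) (Pr : probability T R).
Variable X : {RV Pr >-> config int A}.
Hypotheses (statX : stationary X) (compX : compatible_with X P).
Variables (d' : measure_display) (T' : measurableType d').
Variable Pr' : probability T' R.
Variable Y : {RV Pr' >-> config int A}.
Hypotheses (statY : stationary Y) (compY : compatible_with Y P).

Definition distortion (n : nat) : R :=
  \prod_(j < n) (1 + 2 / kernel_floor P * kernel_var P j).

Let floor_gt0 : 0 < kernel_floor P. Proof. exact: regularP.1. Qed.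

Lemma distortion_ge0 n : 0 <= distortion n.
Proof.
apply: prodr_ge0 => j _; rewrite addr_ge0// mulr_ge0 ?kernel_var_ge0//.
by rewrite divr_ge0// ltW.
Qed.

(** Induction on n: the one-step bounds [L + v] for Y and m, the maximum of
    [L - v] and the floor, for X have a ratio at most [1 + 2 v / floor], since
    [L + v <= m + 2 v] and [floor <= m]. *)
Lemma cylinder_comparison (w : nat -> A) n :
  pr (law Y) (cylinder 0 n w) <= distortion n * pr (law X) (cylinder 0 n w).
Proof.
elim: n => [|n IHn].
  rewrite /distortion big_ord0 mul1r.
  suff cylT : cylinder 0 0 w = setT by rewrite cylT /pr !probability_setT.
  by apply/seteqP; split.
have /andP[_ hiY] := cylinder_step kernelP statY compY w n.
have /andP[loX _] := cylinder_step kernelP statX compX w n.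
rewrite /distortion big_ord_recr/= -/(distortion n).
move: hiY loX IHn; set L := P _ _; set v := kernel_var P n.
set pX := pr (law X) (cylinder 0 n w).
set pX' := pr (law X) (cylinder 0 n.+1 w).
set pY := pr (law Y) (cylinder 0 n w).
set pY' := pr (law Y) (cylinder 0 n.+1 w).
set eta := kernel_floor P; set m := Num.max _ _; set K := distortion n.
move=> hiY loX IHn.
have v0 : 0 <= v by exact: kernel_var_ge0.
have K0 : 0 <= K by exact: distortion_ge0.
have pX0 : 0 <= pX by rewrite /pX /pr fine_ge0.
have Lm : L - v <= m by rewrite /m le_max lexx.
have em : eta <= m by rewrite /m le_max lexx orbT.
have Lv : L + v <= (1 + 2 / eta * v) * m.
  have : 2 * v <= 2 / eta * v * m.
    rewrite (_ : _ * m = 2 * v * (m / eta)); last by ring.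
    by rewrite ler_peMr ?mulr_ge0// ler_pdivlMr// mul1r.
  by rewrite mulrDl mul1r; lra.
have L0 : 0 <= L + v.
  by rewrite addr_ge0//; have /andP[] := kernelP.1 (w n) (reversed_word w n).
apply: (le_trans hiY); apply: (le_trans (ler_wpM2l L0 IHn)).
apply: (@le_trans _ _ ((1 + 2 / eta * v) * m * (K * pX))).
  by apply: ler_wpM2r => //; exact: mulr_ge0.
rewrite (_ : _ * m * _ = K * (1 + 2 / eta * v) * (m * pX)); last by ring.
apply: ler_wpM2l => //; rewrite mulr_ge0// addr_ge0// mulr_ge0// divr_ge0//.
exact: ltW floor_gt0.
Qed.

(** Distinct words give disjoint cylinders, so the bound passes to sums. *)
Lemma word_comparison n (Q : {pred {ffun 'I_n -> A}}) k l :
  pr (law Y) [set x | Q (word k n x)] <=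
  distortion n * pr (law X) [set x | Q (word l n x)].
Proof.
rewrite !pr_word mulr_sumr; apply: ler_sum => a _.
rewrite (pr_cylinder_shift k 0 n _ (law_shift_invariant statY)).
rewrite (pr_cylinder_shift l 0 n _ (law_shift_invariant statX)).
exact: cylinder_comparison.
Qed.

(** The logarithm of the distortion is at most a constant times the sum of the
    variations, which is o(n) because these tend to 0 (Cesaro). *)
Lemma distortion_subexponential (e : R) : 0 < e ->
  \forall n \near \oo, distortion n <= expR (e * n%:R).
Proof.
move=> e0.
have c0 : 0 < 2 / kernel_floor P by rewrite divr_gt0.
have /cvgrPdist_le/(_ _ (divr_gt0 e0 c0)) := cesaro regularP.2.
(* [arithmetic_mean u n] averages the n.+1 terms u_0, ..., u_n. *)
move=> [N _ NP]; exists N.+1 => // -[//|n] /= ltNn.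
have := NP n ltNn.
rewrite sub0r normrN /arithmetic_mean/= /series/= big_mkord => H.
have {H} : \sum_(j < n.+1) kernel_var P j <= e / (2 / kernel_floor P) * n.+1%:R.
  by rewrite [leRHS]mulrC -ler_pdivrMl//; exact: le_trans (ler_norm _) H.
rewrite mulrAC ler_pdivlMr// mulrC mulr_sumr => H.
apply: le_trans (_ : expR (\sum_(j < n.+1) 2 / kernel_floor P * kernel_var P j) <= _).
  rewrite /distortion expR_sum; apply: ler_prod => j _; rewrite expR_ge1Dx andbT.
  by rewrite addr_ge0// mulr_ge0 ?(ltW c0)// kernel_var_ge0.
by rewrite ler_expR.
Qed.

End comparison.

(** * Block frequencies *)

Section frequency.
Variables (R : realType) (A : alphabetType) (k : nat) (w : nat -> A).
Hypothesis k_gt0 : (0 < k)%N.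
Variable m : nat.
Implicit Types (a b : {ffun 'I_(m * k) -> A}).

(** Coordinate l lies in the block [l %/ k] at rank [l %% k]; quantifying over
    all coordinates avoids building indices of a product ordinal type. *)
Definition occurs_at (i : nat) a : bool :=
  [forall l : 'I_(m * k), (l %/ k == i)%N ==> (a l == w (l %% k)%N)].

Definition frequency a : R := m%:R^-1 * \sum_(i < m) (occurs_at i a)%:R.

Lemma frequency_itv a : 0 <= frequency a <= 1.
Proof.
rewrite /frequency; case: (posnP m) => [->|m0].
  by rewrite big_ord0 mulr0 lexx ler01.
rewrite mulr_ge0 ?invr_ge0 ?sumr_ge0//= ler_pdivrMl ?ltr0n// mulr1.
rewrite -[in leRHS](card_ord m) -sum1_card natr_sum.
by apply: ler_sum => i _; rewrite lern1 leq_b1.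
Qed.

(** Coordinate j belongs to a single block, so only one summand can change. *)
Lemma frequency_diff (j : 'I_(m * k)) a b : (forall i, i != j -> a i = b i) ->
  frequency a - frequency b =
  m%:R^-1 * ((occurs_at (j %/ k)%N a)%:R - (occurs_at (j %/ k)%N b)%:R).
Proof.
move=> ab; rewrite /frequency -mulrBr -sumrB; congr (_ * _).
have ltj : (j %/ k < m)%N by rewrite ltn_divLR.
rewrite (bigD1 (Ordinal ltj))//= big1 ?addr0// => i ij.
suff -> : occurs_at i a = occurs_at i b by rewrite subrr.
apply: eq_forallb => l; case: eqP => //= li; rewrite ab//.
by apply: contra ij => /eqP lj; apply/eqP/val_inj; rewrite /= -li lj.
Qed.

Hypothesis two_letters : forall c : A, exists c', c' != c.

(** Repeating w in every block and then spoiling the letter at j loses exactly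
    one occurrence: the oscillation bound 1/m is attained at every coordinate. *)
Lemma frequency_pair (j : 'I_(m * k)) : exists a b,
  (forall i, i != j -> a i = b i) /\ frequency a - frequency b = m%:R^-1.
Proof.
have [c cw] := two_letters (w (j %% k)%N).
exists [ffun l : 'I_(m * k) => w (l %% k)%N].
exists [ffun l : 'I_(m * k) => if l == j then c else w (l %% k)%N].
have ab (i : 'I_(m * k)) : i != j -> [ffun l : 'I_(m * k) => w (l %% k)%N] i =
    [ffun l : 'I_(m * k) => if l == j then c else w (l %% k)%N] i.
  by move=> /negbTE ij; rewrite !ffunE ij.
split=> //; rewrite (frequency_diff ab).
have -> : occurs_at (j %/ k)%N [ffun l : 'I_(m * k) => w (l %% k)%N].
  by apply/forallP => l; rewrite ffunE eqxx implybT.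
rewrite (_ : occurs_at _ _ = false) ?subr0 ?mulr1//.
by apply/forallP => /(_ j); rewrite eqxx ffunE eqxx/= (negbTE cw).
Qed.

Lemma osc_frequency (j : 'I_(m * k)) : osc frequency j = m%:R^-1.
Proof.
have [a [b [ab dab]]] := frequency_pair j.
have up : ubound [set r | exists a b, (forall i, i != j -> a i = b i) /\
    r = `|frequency a - frequency b|] m%:R^-1.
  move=> _ [a' [b' [ab' ->]]]; rewrite (frequency_diff ab').
  rewrite normrM ger0_norm ?invr_ge0// ler_piMr ?invr_ge0//.
  by do 2 case: occurs_at; rewrite /= ?subrr ?subr0 ?sub0r ?normrN ?normr0 ?normr1.
have at_ab : [set r | exists a b, (forall i, i != j -> a i = b i) /\
    r = `|frequency a - frequency b|] m%:R^-1.
  by exists a, b; rewrite dab ger0_norm ?invr_ge0.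
apply/eqP; rewrite eq_le; apply/andP; split.
  by apply: ge_sup => //; exists m%:R^-1.
by apply: ub_le_sup => //; exists m%:R^-1.
Qed.

Hypothesis m_gt0 : (0 < m)%N.
Let mR_neq0 : m%:R != 0 :> R. Proof. by rewrite pnatr_eq0 -lt0n. Qed.

(** This value does not depend on m, so the rate g is evaluated at one and the
    same point for all m. *)
Lemma osc_l1_frequency : osc_l1 frequency = k%:R.
Proof.
rewrite /osc_l1 (eq_bigr (fun=> m%:R^-1)) => [|j _]; last exact: osc_frequency.
by rewrite sumr_const card_ord -(mulr_natl m%:R^-1) natrM mulrAC mulfV// mul1r.
Qed.

Lemma osc_l2sq_frequency : osc_l2sq frequency = k%:R / m%:R.
Proof.
rewrite /osc_l2sq (eq_bigr (fun=> m%:R^-1 ^+ 2)) => [|j _]; last first.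
  by rewrite osc_frequency.
by rewrite sumr_const card_ord -(mulr_natl (m%:R^-1 ^+ 2)) natrM; field.
Qed.

Lemma frequency_nonconstant : exists a b, frequency a <> frequency b.
Proof.
have j : 'I_(m * k) by apply: (@Ordinal _ 0); rewrite muln_gt0 m_gt0.
have [a [b [_ dab]]] := frequency_pair j.
exists a, b => /eqP; rewrite -subr_eq0 dab invr_eq0; exact/negP.
Qed.

(** By stationarity each of the m blocks equals w with the same probability. *)
Lemma mean_frequency (mu : probability (config int A) R) : shift_invariant mu ->
  \sum_a frequency a * pr mu (cylinder 0 (m * k) (letters a)) =
  pr mu (cylinder 0 k w).
Proof.
move=> inv; under eq_bigr do rewrite /frequency -mulrA mulr_suml.
rewrite -mulr_sumr exchange_big/=.
rewrite (eq_bigr (fun=> pr mu (cylinder 0 k w))) => [|i _].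
  by rewrite sumr_const card_ord -(mulr_natl (pr _ _)) mulrA mulVf// mul1r.
rewrite (bigID (occurs_at i))/= [X in _ + X]big1 ?addr0; last first.
  by move=> a /negbTE ->; rewrite mul0r.
rewrite (eq_bigr (fun a => pr mu (cylinder 0 (m * k) (letters a)))); last first.
  by move=> a ->; rewrite mul1r.
rewrite -(pr_word mu 0 (occurs_at i)) (pr_cylinder_shift 0 (i * k)%N%:Z)//.
congr (pr mu _); apply/seteqP; split=> x /=.
  move=> /forallP xi j ltjk.
  have ltl : (i * k + j < m * k)%N by have := ltn_ord i; nia.
  have := xi (Ordinal ltl); rewrite /= divnMDl// divn_small// addn0 eqxx/=.
  by rewrite ffunE/= modnMDl modn_small// add0r PoszD => /eqP.
move=> xi; apply/forallP => l; apply/implyP => /eqP li.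
rewrite ffunE add0r -xi ?ltn_mod// -PoszD -li.
by rewrite -divn_eq.
Qed.

End frequency.

Section expectation.
Variables (R : realType) (A : alphabetType).
Variables (d : measure_display) (T : measurableType d) (Pr : probability T R).
Variable X : {RV Pr >-> config int A}.
Hypothesis statX : stationary X.

Lemma block_word n t : block X n t = word 1 n (X t).
Proof. by apply/ffunP => i; rewrite !ffunE; congr (X t _); lia. Qed.

(** A function of a block takes finitely many values, so its mean is a finite
    sum; this brings the concentration hypothesis to the form of
    [mean_frequency]. *)
Lemma expectation_block n (f : {ffun 'I_n -> A} -> R) :
  ('E_Pr[fun t => f (block X n t)])%E =
  (\sum_a f a * pr (law X) (cylinder 0 n (letters a)))%:E.
Proof.
pose E (a : {ffun 'I_n -> A}) : set T := X @^-1` cylinder 1 n (letters a).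
have mE a : measurable (E a).
  by rewrite /E -[_ @^-1` _]setTI; apply: measurable_funP => //;
     exact: measurable_cylinder.
have fE t : (f (block X n t))%:E = (\sum_a (f a)%:E * (\1_(E a) t)%:E)%E.
  rewrite (bigD1 (block X n t))//= big1 => [|a /eqP nea].
    rewrite adde0 indicE mem_set ?mule1// /E /=.
    by apply/word_letters; rewrite block_word.
  rewrite indicE memNset ?mule0// /E /= => /word_letters.
  by rewrite -block_word => /esym.
rewrite unlock; under eq_integral do rewrite /= fE.
have intE a : Pr.-integrable setT (fun t => (f a)%:E * (\1_(E a) t)%:E)%E.
  by apply: integrableZl => //; apply: integrable_indic.
rewrite integral_sum// -sumEFin; apply: eq_bigr => a _.
rewrite integralZl//; last exact: integrable_indic.
rewrite integral_indic// setIT EFinM; congr (_ * _)%E.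
rewrite (pr_cylinder_shift 0 1 n _ (law_shift_invariant statX)).
by rewrite prE//; exact: measurable_cylinder.
Qed.

End expectation.

(** * Uniqueness on cylinders *)

Section uniqueness.
Variables (R : realType) (A : alphabetType) (P : A -> config nat A -> R).
Hypotheses (kernelP : is_probability_kernel P) (regularP : regular_kernel P).
Variables (d : measure_display) (T : measurableType d) (Pr : probability T R).
Variable X : {RV Pr >-> config int A}.
Hypotheses (statX : stationary X) (compX : compatible_with X P).
Hypothesis concX : exponential_concentration X.
Variables (d' : measure_display) (T' : measurableType d').
Variable Pr' : probability T' R.
Variable Y : {RV Pr' >-> config int A}.
Hypotheses (statY : stationary Y) (compY : compatible_with Y P).

(** The reference value is the probability of w under the law of X, also when
    the event is evaluated under the law of Y. *)
Definition deviates k w m (e : R) (a : {ffun 'I_(m * k) -> A}) : bool :=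
  e < `|frequency R w a - pr (law X) (cylinder 0 k w)|.

(** The rate is [c = g e k / k], because the exponent is [g e k / (k / m)]. *)
Lemma frequency_concentration k (w : nat -> A) (e : R) :
  (forall c : A, exists c', c' != c) -> (0 < k)%N -> 0 < e ->
  exists C c, [/\ 0 <= C, 0 < c & forall m, (0 < m)%N ->
    pr (law X) [set x | deviates w e (word 1 (m * k) x)]
      <= C * expR (- (c * m%:R))].
Proof.
move=> two k0 e0; have [C [g [gpos conc]]] := concX.
exists `|C|, (g e k%:R / k%:R); split=> //.
  by rewrite divr_gt0 ?gpos ?ltr0n.
move=> m m0.
have mk0 : (0 < m * k)%N by rewrite muln_gt0 m0.
have := conc _ _ _ mk0 e0 (frequency_nonconstant R w k0 two m0).
rewrite (expectation_block statX) (mean_frequency w k0 m0 (law_shift_invariant statX)).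
rewrite osc_l1_frequency// osc_l2sq_frequency//= => H.
have -> : g e k%:R / k%:R * m%:R = g e k%:R / (k%:R / m%:R).
  by rewrite invf_div; ring.
apply: le_trans (_ : C * expR (- (g e k%:R / (k%:R / m%:R))) <= _); last first.
  by apply: ler_wpM2r; [exact: expR_ge0|exact: ler_norm].
rewrite -lee_fin prE; last exact: measurable_word.
apply: le_trans H; rewrite le_eqVlt; apply/orP; left; apply/eqP.
by congr (Pr _); apply/seteqP; split=> t /=; rewrite /deviates block_word.
Qed.

(** The Y-probability of w is the Y-mean of the frequency, whose distance to the
    reference value is at most e off the deviation event and at most 1 on it. *)
Lemma cylinder_deviation k (w : nat -> A) m (e : R) : (0 < k)%N -> (0 < m)%N ->
  0 < e ->
  `|pr (law Y) (cylinder 0 k w) - pr (law X) (cylinder 0 k w)| <=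
  e + pr (law Y) [set x | deviates w e (word 0 (m * k) x)].
Proof.
move=> k0 m0 e0; rewrite pr_word.
set q := fun a : {ffun 'I_(m * k) -> A} =>
  pr (law Y) (cylinder 0 (m * k) (letters a)).
have q0 a : 0 <= q a by rewrite /q /pr fine_ge0.
have q1 : \sum_a q a = 1.
  have := pr_word (law Y) 0 (fun=> true : bool).
  move=> /(_ (m * k)%N) <-; rewrite (_ : [set _ | _] = setT).
    by rewrite /pr probability_setT.
  by apply/seteqP; split.
have invY := law_shift_invariant statY.
rewrite -(mean_frequency w k0 m0 invY) -/q; set p := pr (law X) _.
have p01 : 0 <= p <= 1.
  rewrite /p /pr fine_ge0//= -lee_fin prE; last exact: measurable_cylinder.
  by apply: probability_le1; exact: measurable_cylinder.
have -> : \sum_a frequency R w a * q a - p = \sum_a (frequency R w a - p) * q a.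
  by under [RHS]eq_bigr do rewrite mulrBl; rewrite sumrB -mulr_sumr q1 mulr1.
apply: le_trans (ler_norm_sum _ _ _) _.
have -> : e + \sum_(a | deviates w e a) q a =
    \sum_a (e * q a + if deviates w e a then q a else 0).
  by rewrite big_split/= -mulr_sumr q1 mulr1 -big_mkcond.
apply: ler_sum => a _; rewrite normrM (ger0_norm (q0 a)).
rewrite /deviates -/p; case: ifP => [_|/negbT]; last first.
  by rewrite -leNgt addr0 => dev; exact: ler_wpM2r.
rewrite -[X in _ <= _ + X]mul1r -mulrDl; apply: ler_wpM2r => //.
have /andP[f0 f1] := frequency_itv R w a; case/andP: p01 => p0 p1.
by rewrite ler_norml; apply/andP; split; lra.
Qed.

(** The distortion over [m * k] letters is eventually at most [expR (c m / 2)],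
    half of the exponential rate c; what remains is [C * expR (- c m / 2)],
    made smaller than e/2 by taking m large. *)
Lemma cylinder_unique k (w : nat -> A) :
  pr (law Y) (cylinder 0 k w) = pr (law X) (cylinder 0 k w).
Proof.
have [k0|k0] := posnP k.
  suff -> : cylinder 0 k w = setT by rewrite /pr !probability_setT.
  by rewrite k0; apply/seteqP; split.
have [two|] := pselect (forall c : A, exists c', c' != c); last first.
  move=> /existsNP[c /forallNP cP].
  have one b : b = c by apply/eqP; apply: contrapT => /negP; exact: cP.
  suff -> : cylinder 0 k w = setT by rewrite /pr !probability_setT.
  by apply/seteqP; split=> // x _ i _; rewrite (one (x _)) (one (w i)).
apply/eqP; rewrite -subr_eq0 -normr_le0; apply/ler_addgt0Pr => e e0.
rewrite add0r.
have e20 : 0 < e / 2 by rewrite divr_gt0.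
have [C [c [C0 c0 conc]]] := frequency_concentration w two k0 e20.
have kR0 : 0 < k%:R :> R by rewrite ltr0n.
have h0 : 0 < c / 2 by rewrite divr_gt0.
have [N _ subexp] := distortion_subexponential kernelP regularP
  (divr_gt0 h0 kR0).
(* [expR u >= 1 + u] reduces the last estimate to [m >= C / (e/2 * c/2)]. *)
pose M := Num.bound (C / (e / 2 * (c / 2))).
pose m := (N + M.+1)%N.
have m0 : (0 < m)%N by rewrite /m; lia.
apply: le_trans (cylinder_deviation w k0 m0 e20) _.
rewrite [leRHS](splitr e) lerD2l.
apply: le_trans (word_comparison kernelP regularP statX compX statY compY _ 0 1) _.
have Nmk : (N <= m * k)%N by rewrite /m; nia.
have D0 := distortion_ge0 kernelP regularP (m * k).
apply: le_trans (ler_wpM2l D0 (conc _ m0)) _.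
have CE0 : 0 <= C * expR (- (c * m%:R)) by rewrite mulr_ge0// expR_ge0.
apply: le_trans (ler_wpM2r CE0 (subexp _ Nmk)) _.
have -> : expR (c / 2 / k%:R * (m * k)%:R) * (C * expR (- (c * m%:R))) =
    C * expR (- (c / 2 * m%:R)).
  rewrite mulrCA -expRD natrM; congr (_ * expR _).
  by field; rewrite pnatr_eq0 -lt0n.
rewrite expRN ler_pdivrMr ?expR_gt0//.
have CM : C / (e / 2 * (c / 2)) <= m%:R.
  apply: le_trans (ltW (archi_boundP _)) _; first by rewrite divr_ge0// ltW// mulr_gt0.
  by rewrite ler_nat /m -/M; lia.
apply: (@le_trans _ _ (e / 2 * (c / 2 * m%:R))).
  rewrite (_ : _ * _ = m%:R * (e / 2 * (c / 2))); last by ring.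
  by rewrite -ler_pdivrMr// mulr_gt0.
rewrite ler_pM2l//; apply: le_trans (expR_ge1Dx _); lra.
Qed.
End uniqueness.

(** * From cylinders to the whole sigma-algebra *)

Section windows.
Variables (A : alphabetType).

(** Events determined by the coordinates in [-N, N].  Unlike cylinders they are
    closed under intersection, as the larger of two windows serves for both. *)
Definition windowed (N : nat) (E : set (config int A)) : Prop :=
  forall x y : config int A,
    (forall i, (`|i| <= N)%N -> x i = y i) -> E x -> E y.

(** A word over the window is read as a configuration by repeating an arbitrary
    letter outside of it; membership in E does not see the difference. *)
Lemma windowed_wordE N E : windowed N E ->
  exists Q : {pred {ffun 'I_(N.*2.+1) -> A}},
    E = [set x | Q (word (- N%:Z) N.*2.+1 x)].
Proof.
pose spread (a : {ffun 'I_(N.*2.+1) -> A}) : config int A :=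
  fun i => letters a `|(i + N%:Z)%R|.
move=> winE; exists (fun a => `[< E (spread a) >]).
have spreadE x i : (`|i| <= N)%N -> spread (word (- N%:Z) N.*2.+1 x) i = x i.
  move=> iN; have lti : (`|(i + N%:Z)%R| < N.*2.+1)%N by lia.
  rewrite /spread -[`|(i + N%:Z)%R|%N]/(val (Ordinal lti)) lettersE ffunE.
  by congr x; rewrite /=; lia.
apply/seteqP; split=> x /=.
  by move=> Ex; apply/asboolP; apply: winE Ex => i iN; rewrite spreadE.
by move=> /asboolP; apply: winE => i iN; exact: spreadE.
Qed.

Lemma windowed_generate :
  measurable = <<s [set E : set (config int A) | exists N, windowed N E] >>.
Proof.
apply/seteqP; split.
  apply: sub_sigma_algebra2 => _ [i [a ->]]; exists `|i|%N => x y xy /= <-.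
  by rewrite xy.
apply: smallest_sub => [|E [N /windowed_wordE[Q ->]]].
  exact: sigma_algebra_measurable.
exact: measurable_word.
Qed.

Lemma windowed_setI : setI_closed [set E | exists N, windowed N E].
Proof.
move=> E F [M winE] [N winF]; exists (maxn M N) => x y xy [Ex Fx].
split; [apply: winE Ex|apply: winF Fx] => i iN; apply: xy.
  by rewrite (leq_trans iN)// leq_maxl.
by rewrite (leq_trans iN)// leq_maxr.
Qed.

End windows.

(** Uniqueness of measures on the intersection-stable generating family of
    windowed events, which are finite unions of cylinders. *)
Lemma law_cylinders_unique (R : realType) (A : alphabetType)
    (mu nu : probability (config int A) R) :
  shift_invariant mu -> shift_invariant nu ->
  (forall n w, pr mu (cylinder 0 n w) = pr nu (cylinder 0 n w)) ->
  forall B, measurable B -> mu B = nu B.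
Proof.
move=> invmu invnu munu.
apply: (measure_unique _ (fun=> setT) (windowed_generate A)).
- exact: windowed_setI.
- by move=> _; exists 0%N.
- by apply/seteqP; split=> // x _; exists 0%N.
- move=> E [N /windowed_wordE[Q ->]].
  have mQ := measurable_word (- N%:Z) Q.
  apply: etrans (esym (prE mu mQ)) (etrans _ (prE nu mQ)).
  rewrite !pr_word; congr (_%:E); apply: eq_bigr => a _.
  by rewrite (pr_cylinder_shift _ 0)// munu (pr_cylinder_shift _ 0 _ _ invnu).
- by move=> _; exact: le_lt_trans (probability_le1 mu measurableT) (ltry 1).
Qed.

Theorem theorem4 (R : realType) (A : alphabetType)
    (P : A -> config nat A -> R)
    (kernelP : is_probability_kernel P) (regularP : regular_kernel P)
    (d : measure_display) (T : measurableType d) (Pr : probability T R)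
    (X : {RV Pr >-> config int A})
    (statX : stationary X) (compX : compatible_with X P)
    (concX : exponential_concentration X)
    (d' : measure_display) (T' : measurableType d') (Pr' : probability T' R)
    (Y : {RV Pr' >-> config int A})
    (statY : stationary Y) (compY : compatible_with Y P) :
  same_law Y X.
Proof.
apply: law_cylinders_unique; try exact: law_shift_invariant.
move=> n w.
exact: (cylinder_unique kernelP regularP statX compX concX statY compY).
Qed.
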